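(* Let $R(\xi)\in\mathbb{R}[\xi]^{g\times q}$ be a polynomial matrix and let $c\in(\mathbb{R}^g)^{\mathbb{Z}}$ be a sequence. Then there exists $w\in(\mathbb{R}^q)^{\mathbb{Z}}$ with $R(\sigma)w=c$ (i.e. $c\in\operatorname{im}R(\sigma)$) if and only if $\lambda(\sigma)c=0$ for all $\lambda(\xi)\in\mathbf{syz}\,R(\xi)$.
   Context: The shift on two-sided sequences is $(\sigma w)(t)=w(t+1)$, and a polynomial matrix $R(\xi)=\sum_{i=0}^dR_i\xi^i$ acts by $(R(\sigma)w)(t)=\sum_{i=0}^dR_iw(t+i)$. The image is $\operatorname{im}R(\sigma)=\{v\in(\mathbb{R}^g)^{\mathbb{Z}}:\exists w\in(\mathbb{R}^q)^{\mathbb{Z}},\ v=R(\sigma)w\}$. The (left) syzygy module of $R(\xi)\in\mathbb{R}[\xi]^{g\times q}$ is $\mathbf{syz}\,R(\xi)=\{\lambda(\xi)\in\mathbb{R}[\xi]^{1\times g}:\lambda(\xi)R(\xi)=0\}$. *)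

(* Defs.v *)
(* MathComp world; the real numbers are an arbitrary [R : realType]. *)
From HB Require Import structures.
From mathcomp Require Import all_boot all_order all_algebra.
From mathcomp Require Import boolp classical_sets reals.

Set Implicit Arguments.
Unset Strict Implicit.
Unset Printing Implicit Defensive.

Import GRing.Theory.
Local Open Scope ring_scope.

Definition signal (R : realType) (n : nat) : Type := int -> 'cV[R]_n.

Definition shift (R : realType) (n : nat) (w : signal R n) : signal R n :=
  fun t => w (t + 1).

Definition coef_pmx (R : realType) (g q : nat)
    (P : 'M[{poly R}]_(g, q)) (i : nat) : 'M[R]_(g, q) :=
  map_mx (fun p : {poly R} => p`_i) P.

(* One more than the degree of P, and 0 if P = 0, as for [size] on {poly R}. *)
Definition size_pmx (R : realType) (g q : nat) (P : 'M[{poly R}]_(g, q)) : nat :=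
  \max_(k < g) \max_(l < q) size (P k l).

Definition shift_op (R : realType) (g q : nat) (P : 'M[{poly R}]_(g, q))
    (w : signal R q) : signal R g :=
  fun t => \sum_(i < size_pmx P) coef_pmx P i *m w (t + i%:Z).

Definition syz (R : realType) (g q : nat) (P : 'M[{poly R}]_(g, q)) :
    set 'rV[{poly R}]_g :=
  [set lambda | lambda *m P = 0]%classic.

Lemma iter_shiftE (R : realType) (n : nat) (w : signal R n) (i : nat) (t : int) :
  iter i (@shift R n) w t = w (t + i%:Z).
Proof.
elim: i t => [|i IHi] t; first by rewrite addr0.
by rewrite iterS /shift IHi -addrA -PoszD add1n.
Qed.

(* The number of terms is immaterial once it exceeds the degree. *)
Lemma shift_opE (R : realType) (g q : nat) (P : 'M[{poly R}]_(g, q))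
    (w : signal R q) (d : nat) (t : int) : (size_pmx P <= d)%N ->
  shift_op P w t = \sum_(i < d) coef_pmx P i *m w (t + i%:Z).
Proof.
move=> le_Pd; rewrite /shift_op.
rewrite (big_ord_widen d (fun i => coef_pmx P i *m w (t + i%:Z)) le_Pd).
rewrite big_mkcond; apply: eq_bigr => i _; case: ltnP => // le_Pi.
suff ->: coef_pmx P i = 0 by rewrite mul0mx.
apply/matrixP => k l; rewrite !mxE nth_default // (leq_trans _ le_Pi) //.
apply: leq_trans (leq_bigmax k).
exact: (leq_bigmax (F := fun l => size (P k l)) l).
Qed.

(* Main.v *)
(* The sequences Z -> F form a divisible module over the principal ideal domain
   F[X], and solvability over a divisible module is proved by induction on the
   number of columns. Write P = (p | P'). The ideal {lambda p : lambda P' = 0} is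
   generated by some d = lambda0 p; solving d w1 = lambda0 c by divisibility makes
   the right-hand side c - p w1 compatible with all syzygies of P'. *)
Require Import Defs.
From HB Require Import structures.
From mathcomp Require Import all_boot all_order all_algebra.
From mathcomp Require Import boolp classical_sets reals.
From mathcomp Require Import functions zify.

Set Implicit Arguments.
Unset Strict Implicit.
Unset Printing Implicit Defensive.

Import GRing.Theory.
Local Open Scope ring_scope.

(** Division by a nonzero element of least size leaves a remainder in [I] of smaller size, hence 0.
    If [I] has no nonzero element, [d = 0] serves. *)
Lemma poly_ideal_principal (F : fieldType) (I : {poly F} -> Prop) :
    I 0 -> (forall p q, I p -> I q -> I (p + q)) ->
    (forall a p, I p -> I (a * p)) ->
  exists2 d, I d & forall p, I p -> d %| p.
Proof.
move=> I0 ID IM; have [[p0 Ip0 p0_neq0]|noI] := pselect (exists2 p, I p & p != 0).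
  pose Q n := `[< exists p, [/\ I p, p != 0 & size p = n] >].
  have exQ : exists n, Q n by exists (size p0); apply/asboolP; exists p0.
  case: (ex_minnP exQ) => n /asboolP[d [Id d_neq0 <-]] min_d.
  exists d => // p Ip; rewrite /dvdp; apply: contraT => r_neq0.
  have /min_d : Q (size (p %% d)).
    apply/asboolP; exists (p %% d); split=> //.
    have -> : p %% d = p + (- (p %/ d)) * d.
      by rewrite {2}(divp_eq p d) mulNr addrAC subrr add0r.
    by apply: ID => //; apply: IM.
  by rewrite leqNgt ltn_modp d_neq0.
exists 0 => // p Ip; rewrite dvd0p; apply: contraT => p_neq0.
by case: noI; exists p.
Qed.

(** * Linear systems over a divisible module *)

Section DivisibleModule.
Variables (F : fieldType) (V : lmodType {poly F}).

Lemma divisible_solvable (g q : nat) (P : 'M[{poly F}]_(g, q)) (c : 'I_g -> V) :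
    (forall (d : {poly F}) (v : V), d != 0 -> exists w, d *: w = v) ->
    (forall lambda : 'rV_g, lambda *m P = 0 -> \sum_k lambda 0 k *: c k = 0) ->
  exists w : 'I_q -> V, forall k, \sum_l P k l *: w l = c k.
Proof.
move=> div; elim: q P c => [|q IHq] P c syzP0.
  (* Without columns every row is a syzygy, and the unit row at [k] forces [c k = 0]. *)
  exists (fun=> 0) => k; rewrite big_ord0.
  have := syzP0 (delta_mx 0 k); rewrite [_ *m P]thinmx0 => /(_ erefl) /esym.
  rewrite (bigD1 k) //= big1 ?addr0 => [|j jk]; last first.
    by rewrite mxE (negPf jk) andbF scale0r.
  by rewrite mxE !eqxx scale1r.
rewrite -[q.+1]/(1 + q)%N in P syzP0 *.
pose p := lsubmx P; pose P' := rsubmx P.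
have PE lambda : lambda *m P = row_mx (lambda *m p) (lambda *m P').
  by rewrite -mul_mx_row hsubmxK.
pose I a := exists2 lambda : 'rV_g, lambda *m P' = 0 & (lambda *m p) 0 0 = a.
have [|||d [l0 l0P' l0p] dmin] := @poly_ideal_principal F I.
- by exists 0; rewrite ?mul0mx ?mxE.
- move=> a b [l lP <-] [m mP <-]; exists (l + m); first by rewrite mulmxDl lP mP addr0.
  by rewrite mulmxDl mxE.
- by move=> a _ [l lP <-]; exists (a *: l); rewrite -scalemxAl ?lP ?scaler0 // mxE.
have [w1 w1P] : exists w1, d *: w1 = \sum_k l0 0 k *: c k.
  (* If [d = 0], then [l0] is itself a syzygy of [P], so the right-hand side vanishes and [w1 = 0]
     works. *)
  have [d0|] := eqVneq d 0; last exact: div.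
  exists 0; rewrite scaler0 syzP0 // PE l0P'.
  rewrite [l0 *m p](_ : _ = 0) ?row_mx0 //.
  by apply/matrixP => i j; rewrite !ord1 l0p d0 mxE.
have [|w wP] := IHq P' (fun k => c k - p k 0 *: w1).
  move=> l lP'; have /dvdpP[a lpE] : d %| (l *m p) 0 0 by apply: dmin; exists l.
  (* Subtracting [a *: l0] cancels [l *m p] and keeps [P'] annihilated. *)
  have /syzP0 : (l - a *: l0) *m P = 0.
    rewrite PE !mulmxBl -!scalemxAl l0P' lP' scaler0 subr0.
    rewrite [_ - _](_ : _ = 0) ?row_mx0 //.
    by apply/matrixP => i j; rewrite !ord1 [LHS]mxE lpE [X in _ + X]mxE [X in - X]mxE l0p mxE subrr.
  under eq_bigr do rewrite !mxE scalerBl -scalerA.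
  rewrite sumrB -scaler_sumr -w1P scalerA -lpE mxE => lc0.
  rewrite -[RHS]lc0 scaler_suml -sumrB; apply: eq_bigr => k _.
  by rewrite scalerBr scalerA.
exists (fun l => match fintype.split l with inl _ => w1 | inr j => w j end) => k.
rewrite big_split_ord /= big_ord1.
case: splitP => [_ _|? //].
transitivity (p k 0 *: w1 + \sum_l P' k l *: w l); last by rewrite wP addrC subrK.
congr (_ + _); first by rewrite mxE.
apply: eq_bigr => i _; rewrite mxE; case: splitP => j /=.
  by move=> ij; have := ltn_ord j; rewrite -ij.
by move=> /addnI /ord_inj ->.
Qed.

End DivisibleModule.

(** * Scalar sequences as a module over the polynomials, ['X] acting as the shift *)

Definition seqmod (F : fieldType) : Type := int -> F.

Section SeqModule.
Variable F : fieldType.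
Implicit Types (p : {poly F}) (w : seqmod F) (t : int).

HB.instance Definition _ := GRing.Zmodule.copy (seqmod F) (int -> F).

Lemma seqmodDE (v w : seqmod F) t : (v + w) t = v t + w t.
Proof. by []. Qed.

Lemma seqmod_sumE (I : Type) (r : seq I) (f : I -> seqmod F) t :
  (\sum_(i <- r) f i) t = \sum_(i <- r) f i t.
Proof. by elim/big_rec2: _ => // i x y _ <-. Qed.

Definition poly_shift p w : seqmod F :=
  fun t => \sum_(i < size p) p`_i * w (t + i%:Z).

Lemma poly_shift_widen p w t n : (size p <= n)%N ->
  poly_shift p w t = \sum_(i < n) p`_i * w (t + i%:Z).
Proof.
move=> le_pn; rewrite /poly_shift (big_ord_widen n (fun i => p`_i * w (t + i%:Z))) //.
rewrite big_mkcond; apply: eq_bigr => i _; case: ltnP => // le_pi.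
by rewrite nth_default ?mul0r.
Qed.

Lemma poly_shiftDr p : {morph poly_shift p : v w / v + w}.
Proof.
move=> v w; apply/funext => t; rewrite seqmodDE /poly_shift -big_split /=.
by apply: eq_bigr => i _; rewrite mulrDr.
Qed.

Lemma poly_shiftDl w : {morph poly_shift^~ w : p q / p + q}.
Proof.
move=> p q; apply/funext => t; rewrite seqmodDE.
pose n := maxn (size p) (size q).
rewrite !(@poly_shift_widen _ _ _ n) ?leq_maxl ?leq_maxr ?size_polyD //.
by rewrite -big_split /=; apply: eq_bigr => i _; rewrite coefD mulrDl.
Qed.

Lemma poly_shiftC a w t : poly_shift a%:P w t = a * w t.
Proof.
by rewrite (@poly_shift_widen _ _ _ 1) ?size_polyC_leq1 // big_ord1 coefC addr0.
Qed.

Lemma poly_shiftCM a p w t : poly_shift (a%:P * p) w t = a * poly_shift p w t.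
Proof.
rewrite (@poly_shift_widen _ _ _ (size p)); last first.
  by rewrite mul_polyC size_scale_leq.
by rewrite mulr_sumr; apply: eq_bigr => i _; rewrite coefCM mulrA.
Qed.

Lemma poly_shiftMX p w t : poly_shift (p * 'X) w t = poly_shift p w (t + 1).
Proof.
rewrite (@poly_shift_widen _ _ _ (size p).+1); last first.
  by apply: leq_trans (size_polyMleq _ _) _; rewrite size_polyX addn2.
rewrite big_ord_recl coefMX mul0r add0r; apply: eq_bigr => i _.
by rewrite coefMX /= -addrA -PoszD.
Qed.

(** Horner induction on [p]: the action is additive in [p], constants scale, and a factor ['X]
    advances time by 1. *)
Lemma poly_shift_comp p q w : poly_shift p (poly_shift q w) = poly_shift (p * q) w.
Proof.
elim/poly_ind: p => [|p a IHp]; apply/funext => t.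
  by rewrite mul0r /poly_shift size_poly0 !big_ord0.
rewrite mulrDl !poly_shiftDl !seqmodDE poly_shiftC poly_shiftCM; congr (_ + _).
by rewrite mulrAC !poly_shiftMX IHp.
Qed.

Lemma poly_shift1 : left_id 1 poly_shift.
Proof. by move=> w; apply/funext => t; rewrite poly_shiftC mul1r. Qed.

HB.instance Definition _ := GRing.Zmodule_isLmodule.Build {poly F} (seqmod F)
  poly_shift_comp poly_shift1 poly_shiftDr poly_shiftDl.

(** * Divisibility of the sequence module *)

(** The [k]-th equation determines [W k] from the earlier values, as [a 0] is invertible. *)
Lemma power_series_div (a c : nat -> F) : a 0 != 0 ->
  exists W : nat -> F, forall k, \sum_(i < k.+1) a i * W (k - i)%N = c k.
Proof.
move=> a0.
(* [s n] lists the first [n] values of [W]; carrying the whole list gives the recursion access to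
   all earlier values. *)
pose next (s : seq F) :=
  rcons s ((c (size s) - \sum_(i < size s) a i.+1 * s`_(size s - i.+1)) / a 0).
pose s n := iter n next [::].
have size_s n : size (s n) = n by elim: n => //= n IHn; rewrite size_rcons IHn.
have s_stable n m : (n < m)%N -> (s m)`_n = (s n.+1)`_n.
  elim: m => // m IHm; rewrite ltnS leq_eqVlt => /predU1P[-> //|lt_nm].
  by rewrite -IHm //= nth_rcons size_s lt_nm.
exists (fun n => (s n.+1)`_n) => k; rewrite big_ord_recl subn0 /=.
rewrite nth_rcons size_s ltnn eqxx mulrC divfK //.
rewrite [X in _ - X + _](eq_bigr (fun i : 'I_k => a i.+1 * (s (k - i.+1).+1)`_(k - i.+1))).
  exact: subrK.
by by move=> i _; rewrite -(@s_stable _ k) //; have := ltn_ord i; lia.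
Qed.

Definition extend0 (W : nat -> F) (z : int) : F := if z is Posz k then W k else 0.

(** Carries the Cauchy product over to two-sided sequences. For [z = k >= 0] both sums equal the one
    with [n + k.+1] terms: those with [i >= n] vanish through [a], those with [i > k] through
    [extend0]. *)
Lemma extend0_conv (a W c : nat -> F) n z :
    (forall k, \sum_(i < k.+1) a i * W (k - i)%N = c k) ->
    (forall i, (n <= i)%N -> a i = 0) ->
  \sum_(i < n) a i * extend0 W (z - i%:Z) = extend0 c z.
Proof.
move=> Wc a0; case: z => k /=; last first.
  by rewrite big1 // => i _; rewrite (_ : Negz k - _ = Negz (k + i)) ?mulr0 //; lia.
pose f i := a i * extend0 W (k%:Z - i%:Z).
transitivity (\sum_(i < n + k.+1) f i).
  rewrite big_split_ord /= [X in _ + X]big1 ?addr0 // => i _.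
  by rewrite /f a0 ?mul0r ?leq_addr.
rewrite addnC big_split_ord /= [X in _ + X]big1 ?addr0 => [|i _]; last first.
  by rewrite /f (_ : _ - _ = Negz i) ?mulr0 //; lia.
rewrite -Wc; apply: eq_bigr => i _; rewrite /f.
by have := ltn_ord i => ?; rewrite (_ : _ - _ = Posz (k - i)) //; lia.
Qed.

(* The leading coefficient drives a recursion towards +oo, started at 0. *)
Lemma poly_shift_forward p (c : nat -> F) : p != 0 ->
  exists w, poly_shift p w = extend0 c.
Proof.
move=> p0; pose n := (size p).-1.
have sp : size p = n.+1 by rewrite prednK // size_poly_gt0.
(* Coefficients from the leading one down; the delay by the degree [n] in the witness matches this
   reversal. *)
pose a i := if (i <= n)%N then p`_(n - i) else 0.
have [|W Wc] := @power_series_div a c; first by rewrite /a subn0 -lead_coefE lead_coef_eq0.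
exists (fun t => extend0 W (t - n%:Z)); apply/funext => t.
rewrite -(@extend0_conv a W c n.+1 t) //; last first.
  by move=> i; rewrite ltnNge /a => /negPf ->.
rewrite /poly_shift sp (reindex_inj rev_ord_inj); apply: eq_bigr => -[i /= lti] _.
rewrite /a -ltnS lti subSS; congr (_ * extend0 _ _); lia.
Qed.

(* The lowest nonzero coefficient drives a recursion towards -oo. *)
Lemma poly_shift_backward p (c : nat -> F) : p != 0 ->
  exists w, poly_shift p w = (fun t => extend0 c (- 1 - t)).
Proof.
move=> p0.
have ex_m : exists m, p`_m != 0 by exists (size p).-1; rewrite -lead_coefE lead_coef_eq0.
case: (ex_minnP ex_m) => m pm min_m.
have [|W Wc] := @power_series_div (fun i => p`_(m + i)) c; first by rewrite addn0.
(* The reflection of [t] to [- 1 - t] swaps negative and nonnegative times; the offset [m] offsets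
   the [m] vanishing low coefficients. *)
exists (fun t => extend0 W (m%:Z - 1 - t)); apply/funext => t.
rewrite -(@extend0_conv (fun i => p`_(m + i)) W c (size p)) //; last first.
  by move=> i le_pi; rewrite nth_default // (leq_trans le_pi) ?leq_addl.
rewrite (@poly_shift_widen _ _ _ (m + size p)) ?leq_addl // big_split_ord /=.
rewrite big1 ?add0r => [|i _]; last first.
  have [->|/min_m] := eqVneq p`_i 0; first by rewrite mul0r.
  by rewrite leqNgt ltn_ord.
by apply: eq_bigr => i _; congr (_ * extend0 _ _); lia.
Qed.

(** Cut [v] at time 0, solve for each half separately and add the solutions. *)
Lemma seqmod_divisible p (v : seqmod F) : p != 0 -> exists w : seqmod F, p *: w = v.
Proof.
move=> p0; have [w1 w1P] := @poly_shift_forward p (fun k => v k) p0.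
have [w2 w2P] := @poly_shift_backward p (fun k => v (Negz k)) p0.
exists (w1 + w2); rewrite scalerDr; apply/funext => t; rewrite seqmodDE.
rewrite -[p *: w1]/(poly_shift p w1) -[p *: w2]/(poly_shift p w2) w1P w2P.
case: t => k /=.
  by rewrite (_ : - 1 - k%:Z = Negz k) ?addr0 //; lia.
by rewrite add0r subSS subn0.
Qed.

End SeqModule.

(** * From vector signals to systems over the sequence module *)

Definition channel (R : realType) (n : nat) (w : signal R n) (l : 'I_n) : seqmod R :=
  fun t => w t l 0.

Lemma shift_op_channel (R : realType) (g q : nat) (P : 'M[{poly R}]_(g, q))
    (w : signal R q) k :
  channel (shift_op P w) k = \sum_l P k l *: channel w l.
Proof.
apply/funext => t; rewrite seqmod_sumE /channel /shift_op summxE.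
under eq_bigr do rewrite mxE.
rewrite exchange_big; apply: eq_bigr => l _.
rewrite -[RHS]/(poly_shift (P k l) (channel w l) t).
rewrite (@poly_shift_widen _ _ _ _ (size_pmx P)).
  by apply: eq_bigr => i _; rewrite mxE.
apply: leq_trans (leq_bigmax k).
exact: (leq_bigmax (F := fun l => size (P k l)) l).
Qed.

Lemma channel_inj (R : realType) (n : nat) (v w : signal R n) :
  (forall l, channel v l = channel w l) -> v = w.
Proof.
move=> vw; apply/funext => t; apply/matrixP => i j; rewrite ord1.
exact: (congr1 (fun f : seqmod R => f t) (vw i)).
Qed.

Theorem theorem10 (R : realType) (g q : nat) (P : 'M[{poly R}]_(g, q))
    (c : signal R g) :
  (exists w : signal R q, shift_op P w = c) <->
  (forall lambda : 'rV[{poly R}]_g, syz P lambda ->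
     shift_op lambda c = (fun _ : int => 0)).
Proof.
split=> [[w <-] lambda lP|csyz].
  apply: channel_inj => i; rewrite ord1 shift_op_channel.
  under eq_bigr do rewrite shift_op_channel scaler_sumr.
  (* Exchanging the sums leaves the entries of [lambda *m P] acting on the channels of [w]. *)
  rewrite exchange_big big1 => [|l _]; first by apply/funext => t; rewrite /channel mxE.
  under eq_bigr do rewrite scalerA.
  rewrite -scaler_suml; have /matrixP/(_ 0 l) := lP.
  by rewrite !mxE => ->; rewrite scale0r.
have [||w wP] := @divisible_solvable R (seqmod R) g q P (channel c).
- exact: seqmod_divisible.
- move=> lambda /csyz lc; rewrite -shift_op_channel lc.
  by apply/funext => t; rewrite /channel mxE.
exists (fun t => \col_l w l t); apply: channel_inj => k.
rewrite shift_op_channel -wP; apply: eq_bigr => l _; congr (_ *: _).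
by apply/funext => t; rewrite /channel mxE.
Qed.
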